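(* Let $q$ be a prime power with $q-1=ml^2$ for integers $l,m\ge 2$. Let $\theta$ be a primitive element of $\mathbb{F}_q$, $\beta=\theta^l$, $C=\langle\beta^m\rangle$, and $A_j=\beta^jC$ for $0\le j\le m-1$. Let $Q=q^t$ with $t$ a positive integer, $M=(Q-1)/l^2$, let $\tilde\theta$ be a primitive element of $\mathbb{F}_Q$ with $\theta=\tilde\theta^{(Q-1)/(q-1)}=\tilde\theta^{M/m}$, and put $\tilde\beta=\tilde\theta^l$, $\tilde C=\langle\tilde\beta^M\rangle$, $\tilde A_k=\tilde\beta^k\tilde C$ for $0\le k\le M-1$. Assume $\gcd(l,t)=1$. Then for any non-empty subset $S\subseteq\{1,\dots,m-1\}$, the family $\{A_0,\dots,A_{m-1}\}$ is a $(q,m,l;|S|)$-$S$-CEDF in $(\mathbb{F}_q,+)$ if and only if the family $\{\tilde A_0,\dots,\tilde A_{M-1}\}$ is a $(Q,M,l;|S|)$-$\tilde S$-CEDF in $(\mathbb{F}_Q,+)$, where $\tilde S=\{\tfrac{M}{m}c:\ c\in S\}\subseteq\{1,\dots,M-1\}$.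
   Context: Let $(G,+)$ be a finite abelian group of order $n$ (written additively), let $l,m\ge 2$, and let $S$ be a non-empty subset of $\{1,\dots,m-1\}$. For non-empty subsets $A,B\subseteq G$, $\Delta(A,B)$ denotes the multiset $\{\{a-b: a\in A, b\in B\}\}$. A family $\{A_0,\dots,A_{m-1}\}$ of $m$ pairwise disjoint subsets of $G$ is an $(n,m,l;\lambda)$-$S$-circular external difference family (CEDF) in $G$ if $|A_i|=l$ for all $i$ and each nonzero $g\in G$ occurs exactly $\lambda$ times in the multiset union $\bigcup_{c\in S}\bigcup_{i=0}^{m-1}\Delta(A_{i+c},A_i)$, where subscripts are taken modulo $m$. Here $\mathbb{F}_q$ is regarded as a subfield of $\mathbb{F}_Q$. *)

(* Defs.v *)
From HB Require Import structures.
From mathcomp Require Import all_boot all_order all_algebra all_fingroup.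
From mathcomp Require Import all_solvable all_field.
From mathcomp Require Import finmap multiset.

Set Implicit Arguments.
Unset Strict Implicit.
Unset Printing Implicit Defensive.

Import GRing.Theory.
Local Open Scope ring_scope.

Definition Delta (G : finZmodType) (A B : {set G}) : {mset G}%mset :=
  seq_mset [seq a - b | a <- enum A, b <- enum B].

(* The index i + c reduced modulo m; the inhabitant i of 'I_m gives 0 < m. *)
Definition shift_idx (m : nat) (i : 'I_m) (c : nat) : 'I_m :=
  Ordinal (ltn_pmod (i + c) (leq_ltn_trans (leq0n i) (ltn_ord i))).

(* Multiset union adds multiplicities, so it is msetD, not msetU. *)
Definition external_differences (G : finZmodType) (m : nat) (S : {fset nat})
    (A : 'I_m -> {set G}) : {mset G}%mset :=
  \big[msetD/mset0]_(c <- S) \big[msetD/mset0]_(i < m)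
    Delta (A (shift_idx i c)) (A i).

Definition index_set (m : nat) (S : {fset nat}) : Prop :=
  forall c, c \in S -> (1 <= c <= m - 1)%N.

Record is_CEDF (G : finZmodType) (n m l lambda : nat) (S : {fset nat})
    (A : 'I_m -> {set G}) : Prop := IsCEDF {
  cedf_order : #|G| = n;
  cedf_l_ge2 : (2 <= l)%N;
  cedf_m_ge2 : (2 <= m)%N;
  cedf_S_neq0 : S != fset0;
  cedf_S_index : index_set m S;
  cedf_disjoint : forall i j, i != j -> [disjoint A i & A j];
  cedf_card : forall i, #|A i| = l;
  cedf_diff : forall g, g != 0 -> external_differences S A g = lambda
}.
Arguments is_CEDF : clear implicits.

Definition primitive_element (F : finFieldType) (theta : {unit F}) : Prop :=
  generator [set: {unit F}] theta.

(* The coset beta^j <beta^m> is formed in the unit group of F, then viewed as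
   a subset of F. *)
Definition power_coset (F : finFieldType) (beta : {unit F}) (m : nat)
    (j : 'I_m) : {set F} :=
  [set val u | u in ((beta ^+ j) *: <[beta ^+ m]>)%g].

Definition scale_set (k : nat) (S : {fset nat}) : {fset nat} :=
  [fset (k * c)%N | c in S]%fset.

(* Main.v *)
Require Import Defs.
From HB Require Import structures.
From mathcomp Require Import all_boot all_order all_algebra all_fingroup.
From mathcomp Require Import all_solvable all_field.
From mathcomp Require Import finmap multiset.

Set Implicit Arguments.
Unset Strict Implicit.
Unset Printing Implicit Defensive.

Import GRing.Theory.
Local Open Scope ring_scope.

(** With [b = theta ^+ l], the number of representations of [g != 0] as an
    external difference is the number of pairs [(c, k)], [c] in [S], [k < l],
    such that [b ^+ (c + m * k) - 1] lies in the coset of [g] modulo <[b]>, the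
    group of [l]-th powers. With [K = (Q - 1) / (q - 1)] one has
    [theta = theta' ^+ K] and [M = K * m], so replacing [b], [m], [S] by
    [theta' ^+ l], [M], [K S] produces the same elements, now sorted modulo the
    [l]-th powers of F_Q. Since [q = 1] mod [l], [K = 1 + q + ... + q^(t-1)] is
    [t] mod [l], hence prime to [l], and the two quotients by [l]-th powers
    are identified by the inclusion of F_q in F_Q. *)

(** * Multiplicities of external differences as sums of truth values *)

Lemma sum_eq_inj (I : finType) (T : eqType) (P : pred I) (f : I -> T) (y : T) :
  {in P &, injective f} ->
  (\sum_(i | P i) (f i == y) = [exists (i | P i), f i == y])%N.
Proof.
move=> f_inj; case: existsP => [[i /andP [Pi /eqP <-]]|no].
  rewrite (bigD1 i) //= eqxx big1 // => j /andP [Pj ne_ji].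
  by case: eqP => // /(f_inj _ _ Pj Pi) eq_ji; rewrite eq_ji eqxx in ne_ji.
rewrite big1 // => i Pi; case: eqP => // fi; case: no.
by exists i; rewrite Pi fi eqxx.
Qed.

Lemma DeltaE (G : finZmodType) (A B : {set G}) (g : G) :
  Delta A B g = (\sum_(b in B) ((b + g)%R \in A))%N.
Proof.
rewrite /Delta mset_seqE -sum1_count big_mkcond big_allpairs_dep exchange_big /=.
rewrite big_enum /=; apply: eq_bigr => b _.
rewrite big_enum /= (eq_bigr (fun a => nat_of_bool (a - b == g)))%R; last first.
  by move=> a _; case: eqP.
rewrite sum_eq_inj => [|x y _ _ /addIr //]; congr nat_of_bool.
apply/existsP/idP => [[a /andP [hA /eqP <-]]|hA]; first by rewrite subrKC.
by exists (b + g); rewrite hA addrC addKr eqxx.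
Qed.

Lemma external_differencesE (G : finZmodType) (m : nat) (S : {fset nat})
    (A : 'I_m -> {set G}) (g : G) :
  external_differences S A g =
  (\sum_(c <- S) \sum_(i < m) \sum_(b in A i)
     ((b + g)%R \in A (shift_idx i c)))%N.
Proof.
pose ev (B : {mset G}%mset) := B g.
have evD : {morph ev : B C / msetD B C >-> (B + C)%N}.
  by move=> B C; rewrite /ev msetE2.
have ev0 : ev mset0 = 0%N by rewrite /ev mset0E.
rewrite -[LHS]/(ev _) /external_differences (big_morph ev evD ev0).
apply: eq_bigr => c _; rewrite (big_morph ev evD ev0).
by apply: eq_bigr => i _; rewrite /ev DeltaE.
Qed.

(** * Cosets of [<[b ^+ m]>] inside a cyclic group of order [m * l] *)

Section CyclicCosets.

Variables (gT : finGroupType) (b : gT) (m l : nat).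
Hypotheses (m_gt0 : (0 < m)%N) (ob : #[b]%g = (m * l)%N).

Lemma order_expg_factor : #[(b ^+ m)%g]%g = l.
Proof. by rewrite orderXdiv ob ?dvdn_mulr // mulKn. Qed.

Lemma lcoset_cycleP i x :
  reflect (exists k : 'I_l, x = (b ^+ (i + m * k))%g)
    (x \in (b ^+ i *: <[b ^+ m]>)%g).
Proof.
apply: (iffP lcosetP) => [[w /cyclePmin [k lt_k ->] ->]|[k ->]].
  rewrite order_expg_factor in lt_k.
  by exists (Ordinal lt_k); rewrite expgD expgM.
by exists ((b ^+ m) ^+ k)%g; rewrite ?mem_cycle // expgD expgM.
Qed.

Lemma lcoset_cycle_disjoint (i j : 'I_m) : i != j ->
  [disjoint (b ^+ i *: <[b ^+ m]>)%g & (b ^+ j *: <[b ^+ m]>)%g].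
Proof.
apply: contraNT => /pred0Pn [x /andP [/lcoset_cycleP [k ->]]].
case/lcoset_cycleP => k' /eqP; rewrite eq_expg_mod_order ob => /eqP eq_ij.
(* As [m] divides the order of [b], the two exponents also agree modulo [m], where only [i] and [j]
   survive. *)
have /eqP := congr1 (modn^~ m) eq_ij.
rewrite /= !modn_dvdm ?dvdn_mulr // !(mulnC m) ![(_ + _ * m)%N]addnC !modnMDl.
by rewrite !modn_small.
Qed.

Lemma cycle_bigcup_lcoset :
  \bigcup_(i < m) (b ^+ i *: <[b ^+ m]>)%g = <[b]>%g.
Proof.
apply/setP => x; apply/bigcupP/cycleP => [[i _ /lcoset_cycleP [k ->]]|[n ->]].
  by exists (i + m * k)%N.
exists (Ordinal (ltn_pmod n m_gt0)) => //; apply/lcosetP.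
exists ((b ^+ m) ^+ (n %/ m))%g; first exact: mem_cycle.
by rewrite -expgM -expgD mulnC addnC -divn_eq.
Qed.

(** [shift_idx] reduces its index modulo [m]; this is harmless because [b ^+ m] lies in the
    subgroup. *)
Lemma lcoset_cycle_mod i :
  (b ^+ (i %% m) *: <[b ^+ m]> = b ^+ i *: <[b ^+ m]>)%g.
Proof.
rewrite {2}(divn_eq i m) addnC expgD mulnC expgM.
by rewrite lcosetM (lcoset_id (mem_cycle _ _)).
Qed.

End CyclicCosets.

(** * Counting the external differences of a family of cosets *)

Section PowerCosets.

Variables (F : finFieldType) (b : {unit F}) (m l : nat).
Hypotheses (m_gt0 : (0 < m)%N) (ob : #[b]%g = (m * l)%N).

Lemma power_coset_disjoint (i j : 'I_m) :
  i != j -> [disjoint power_coset b i & power_coset b j].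
Proof.
move/(lcoset_cycle_disjoint m_gt0 ob); rewrite -!setI_eq0 /power_coset.
by rewrite -imsetI => [/eqP ->|x y _ _ /val_inj //]; rewrite imset0.
Qed.

Lemma card_power_coset (i : 'I_m) : #|power_coset b i| = l.
Proof.
rewrite card_imset ?card_lcoset; last exact: val_inj.
exact: order_expg_factor.
Qed.

(* Writing the two elements of a difference as [y * b ^+ (c + m * k)] and [y]
   lets [y] run over the whole of <[b]>, whatever the index of its coset. *)
Lemma external_differences_power_coset (S : {fset nat}) (g : F) :
  index_set m S ->
  external_differences S (@power_coset F b m) g =
  (\sum_(c <- S) \sum_(k < l)
     [exists u in <[b]>%g, (val u * (val b ^+ (c + m * k)%N - 1))%R == g])%N.
Proof.
move=> hS; rewrite external_differencesE.
apply: eq_big_seq => c /hS /andP [c_gt0 c_le].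
have c_lt : (c < m)%N by rewrite -(prednK m_gt0) ltnS -subn1.
transitivity (\sum_(i < m) \sum_(u in (b ^+ i *: <[b ^+ m]>)%g)
    \sum_(k < l) ((val u * (val b ^+ (c + m * k)%N - 1))%R == g))%N.
  apply: eq_bigr => i _.
  rewrite big_imset /=; last by move=> x y _ _ /val_inj.
  (* For fixed [u], distinct [k < l] give distinct values, since [m * k] stays below the order
     [m * l] of [b]. *)
  apply: eq_bigr => u hu; rewrite sum_eq_inj => [|x y _ _]; last first.
    have /mulfI/[apply]/addIr : val u != 0 by rewrite -unitfE (valP u).
    rewrite -!FinRing.val_unitX => /val_inj/eqP; rewrite eq_expg_mod_order ob.
    rewrite eqn_modDl !modn_small ?ltn_pmul2l // eqn_pmul2l //.
    by move/eqP/val_inj.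
  congr nat_of_bool; rewrite /power_coset /= lcoset_cycle_mod // addnC expgD.
  (* With [u] as representative of its own coset, [u + g] lies in the shifted coset iff it is some
     [u * b ^+ (c + m * k)]. *)
  have -> : (b ^+ c * b ^+ i *: <[b ^+ m]> = b ^+ c *: (u *: <[b ^+ m]>))%g.
    by rewrite lcosetM -(lcoset_eqP hu).
  have valE k : val (b ^+ c * (u * (b ^+ m) ^+ k))%g =
      val u * val b ^+ (c + m * k)%N.
    by rewrite -expgM !FinRing.val_unitM !FinRing.val_unitX exprD mulrCA.
  apply/imsetP/existsP => [[_ /lcosetP [_ /lcosetP [w hw ->] ->] e]|[k /eqP e]].
    have /cyclePmin [k lt_k def_w] := hw.
    rewrite (order_expg_factor m_gt0 ob) in lt_k.
    exists (Ordinal lt_k); rewrite mulrBr mulr1 subr_eq [g + _]addrC.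
    by rewrite def_w in e; apply/eqP; exact: esym (etrans e (valE k)).
  exists (b ^+ c * (u * (b ^+ m) ^+ k))%g.
    by rewrite !mem_lcoset !mulKg mem_cycle.
  by apply: etrans (esym (valE k)); rewrite -e mulrBr mulr1 addrC subrK.
rewrite -(partition_disjoint_bigcup _ _ (lcoset_cycle_disjoint m_gt0 ob)).
rewrite (cycle_bigcup_lcoset m_gt0 ob) exchange_big /=; apply: eq_bigr => k _.
(* The factor of [u] is nonzero: [m] divides the order of [b] but, as [0 < c < m], not
   [c + m * k]. *)
rewrite sum_eq_inj // => u v _ _ /mulIf e; apply: val_inj; apply: e.
rewrite subr_eq0 -FinRing.val_unitX -FinRing.val_unit1 (inj_eq val_inj) -order_dvdn ob.
apply/negP => /(dvdn_trans (dvdn_mulr _ (dvdnn m))).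
by rewrite dvdn_addl ?dvdn_mulr // gtnNdvd.
Qed.

End PowerCosets.

(** * Classes modulo [l]-th powers and their behaviour under field extension *)

Lemma primitive_element_order (F : finFieldType) (theta : {unit F}) :
  primitive_element theta -> #[theta]%g = #|F|.-1.
Proof. by move=> /eqP; rewrite -card_finField_unit orderE => ->. Qed.

Lemma primitive_element_power (F : finFieldType) (theta : {unit F}) (x : F) :
  primitive_element theta -> x != 0 -> exists a, x = val theta ^+ a.
Proof.
rewrite -unitfE => /eqP gen_theta Ux.
have : FinRing.unit F Ux \in <[theta]>%g by rewrite -gen_theta inE.
by case/cycleP => a e; exists a; rewrite -FinRing.val_unitX -e.
Qed.

(** Replacing [u] by [u * d] permutes [<[b]>], so solvability depends only on the class of [g]
    modulo [<[b]>]. *)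
Lemma exists_cycle_mul (F : finFieldType) (b d : {unit F}) (x g : F) :
  d \in <[b]>%g ->
  [exists u in <[b]>%g, val u * x == g * val d] =
  [exists u in <[b]>%g, val u * x == g].
Proof.
move=> hd; have nz_d : val d != 0 by rewrite -unitfE (valP d).
apply/exists_inP/exists_inP => -[u hu /eqP e].
  exists (u * d^-1)%g; first by rewrite groupM ?groupV.
  by rewrite FinRing.val_unitM FinRing.val_unitV mulrAC e mulfK.
exists (u * d)%g; first exact: groupM.
by rewrite FinRing.val_unitM mulrAC e.
Qed.

(* As [K] is prime to [l], inclusion induces an isomorphism of F^* modulo
   [l]-th powers onto L^* modulo [l]-th powers; the next two lemmas are its
   injectivity and its surjectivity. *)
Section PowerResidues.

Variables (F L : finFieldType) (iota : {rmorphism F -> L}).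
Variables (theta : {unit F}) (theta' : {unit L}) (l K : nat).
Hypotheses (prim_theta : primitive_element theta)
  (prim_theta' : primitive_element theta').
Hypothesis iota_theta : iota (val theta) = val theta' ^+ K.
Hypotheses (l_dvd : (l %| #[theta']%g)%N) (coprime_Kl : coprime K l).

Lemma exists_cycle_rmorph (x g : F) : g != 0 ->
  [exists u in <[theta' ^+ l]>%g, val u * iota x == iota g] =
  [exists u in <[theta ^+ l]>%g, val u * x == g].
Proof.
move=> nz_g; apply/exists_inP/exists_inP => -[u /cycleP [k ->] /eqP e].
  have nz_x : x != 0.
    apply: contra_neq nz_g => x0; apply/eqP.
    by rewrite -(fmorph_eq0 iota) -e x0 rmorph0 mulr0.
  have nz_gx : g / x != 0 by rewrite mulf_neq0 ?invr_neq0.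
  have [a def_a] := primitive_element_power prim_theta nz_gx.
  have : (theta' ^+ (l * k) == theta' ^+ (K * a))%g.
    rewrite -(inj_eq val_inj) !FinRing.val_unitX (exprM _ K) -iota_theta.
    rewrite -rmorphXn -def_a.
    by rewrite fmorph_div -e mulfK ?fmorph_eq0 // !FinRing.val_unitX exprM.
  (* As [l] divides the order of [theta'], it divides [K * a], hence [a], and [g / x] is an [l]-th
     power in [F]. *)
  rewrite eq_expg_mod_order => /eqP /(congr1 (modn^~ l)).
  rewrite /= !modn_dvdm // modnMr => /esym /eqP; rewrite -/(dvdn _ _).
  rewrite Gauss_dvdr 1?coprime_sym // => /dvdnP [a' def_a'].
  exists ((theta ^+ l) ^+ a')%g; first exact: mem_cycle.
  by rewrite -expgM mulnC -def_a' FinRing.val_unitX -def_a divfK.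
exists ((theta' ^+ l) ^+ (K * k))%g; first exact: mem_cycle.
apply/eqP; rewrite -e rmorphM; congr (_ * _).
rewrite !FinRing.val_unitX !rmorphXn iota_theta -!exprM.
by rewrite mulnCA mulnA.
Qed.

Lemma rmorph_power_residue (h : L) : (0 < K)%N -> h != 0 ->
  exists g : F, exists2 d, d \in <[theta' ^+ l]>%g & iota g = h * val d.
Proof.
move=> K_gt0 /(primitive_element_power prim_theta') [a ->].
(* Bezout: [r * K = s * l + 1], so [iota] sends [theta ^+ (a * r)] to [theta' ^+ a] times an [l]-th
   power. *)
have [r s def_r _] := egcdnP l K_gt0.
exists (val theta ^+ (a * r)), ((theta' ^+ l) ^+ (a * s))%g.
  exact: mem_cycle.
rewrite rmorphXn iota_theta !FinRing.val_unitX -!exprM -exprD.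
congr (_ ^+ _); rewrite mulnCA [(K * r)%N]mulnC def_r (eqP coprime_Kl).
by rewrite mulnDr muln1 addnC mulnA [(_ * l)%N]mulnC.
Qed.

End PowerResidues.

(** * Arithmetic of [K] and the equivalence *)

Lemma sum_expn_mod (l q t : nat) :
  q = 1 %[mod l] -> (\sum_(i < t) q ^ i = t %[mod l])%N.
Proof.
move=> q1; elim: t => [|t IHt]; first by rewrite big_ord0.
rewrite big_ord_recr /= -modnDm IHt -(modnXm t l q) q1 modnXm exp1n modnDm.
by rewrite addn1.
Qed.

Lemma big_scale_set (K : nat) (S : {fset nat}) (f : nat -> nat) : (0 < K)%N ->
  (\sum_(c <- scale_set K S) f c = \sum_(c <- S) f (K * c))%N.
Proof.
move=> K_gt0; rewrite /scale_set big_imfset //= => x y _ _ /eqP.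
by rewrite eqn_pmul2l // => /eqP.
Qed.

Theorem theorem5 (q l m t Q M : nat)
    (F L : finFieldType) (iota : {rmorphism F -> L})
    (theta : {unit F}) (theta' : {unit L})
    (hF : #|F| = q) (hl : (2 <= l)%N) (hm : (2 <= m)%N)
    (hq : (q - 1 = m * l ^ 2)%N)
    (htheta : primitive_element theta)
    (ht : (0 < t)%N) (hQ : Q = (q ^ t)%N) (hL : #|L| = Q)
    (hM : M = ((Q - 1) %/ l ^ 2)%N)
    (htheta' : primitive_element theta')
    (hcompat : iota (val theta) = val theta' ^+ ((Q - 1) %/ (q - 1)))
    (hlt : gcdn l t = 1%N)
    (S : {fset nat}) (hS0 : S != fset0) (hS : index_set m S) :
  index_set M (scale_set (M %/ m) S) /\
  (is_CEDF F q m l #|` S|%fset S (@power_coset F (theta ^+ l)%g m) <->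
   is_CEDF L Q M l #|` S|%fset (scale_set (M %/ m) S)
     (@power_coset L (theta' ^+ l)%g M)).
Proof.
have m_gt0 : (0 < m)%N by apply: ltnW.
have l_gt0 : (0 < l)%N by apply: ltnW.
have q1_gt0 : (0 < q - 1)%N by rewrite hq muln_gt0 m_gt0 expn_gt0 l_gt0.
pose K := (\sum_(i < t) q ^ i)%N.
have Q1 : (Q - 1 = K * (q - 1))%N by rewrite hQ !subn1 predn_exp mulnC.
have K_gt0 : (0 < K)%N.
  by rewrite /K -(prednK ht) big_ord_recl expn0.
have MK : M = (K * m)%N.
  by rewrite hM Q1 hq mulnA mulnK // expn_gt0 l_gt0.
have Mm : (M %/ m)%N = K by rewrite MK mulnK.
have M_gt0 : (0 < M)%N by rewrite MK muln_gt0 K_gt0.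
rewrite Q1 mulnK // in hcompat; rewrite Mm.
have ob : #[(theta ^+ l)%g]%g = (m * l)%N.
  have o_theta := primitive_element_order htheta.
  rewrite hF -subn1 hq in o_theta.
  by rewrite orderXdiv o_theta expnS expn1 mulnA ?mulnK ?dvdn_mull.
have o_theta' := primitive_element_order htheta'.
rewrite hL -subn1 Q1 hq mulnA -MK in o_theta'.
have l_dvd : (l %| #[theta']%g)%N.
  by rewrite o_theta' expnS expn1 mulnA dvdn_mull.
have ob' : #[(theta' ^+ l)%g]%g = (M * l)%N.
  by rewrite orderXdiv // o_theta' expnS expn1 mulnA mulnK.
have coprime_Kl : coprime K l.
  have q_mod : (q = 1 %[mod l])%N.
    rewrite -(@subnK 1 q); last by rewrite ltnW // -subn_gt0.
    by rewrite hq expnS expn1 mulnA modnMDl.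
  by rewrite /coprime gcdnC -gcdn_modr sum_expn_mod // gcdn_modr hlt.
have hS' : index_set M (scale_set K S).
  move=> _ /imfsetP [c /= /hS /andP [c_gt0 c_le] ->].
  rewrite muln_gt0 K_gt0 c_gt0 MK subn1 -ltnS prednK ?muln_gt0 ?K_gt0 //.
  by rewrite ltn_pmul2l // -(prednK m_gt0) ltnS -subn1.
split=> //.
have transfer (g : F) : g != 0 ->
    external_differences (scale_set K S) (@power_coset L (theta' ^+ l)%g M)
      (iota g) =
    external_differences S (@power_coset F (theta ^+ l)%g m) g.
  move=> nz_g; rewrite (external_differences_power_coset m_gt0 ob) //.
  rewrite (external_differences_power_coset M_gt0 ob') // big_scale_set //.
  apply: eq_bigr => c _; apply: eq_bigr => k _; congr nat_of_bool.
  rewrite -(exists_cycle_rmorph htheta hcompat l_dvd coprime_Kl) //.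
  (* Since [M = K * m], [theta' ^+ (l * (K * c + M * k))] is the image of
     [theta ^+ (l * (c + m * k))]. *)
  rewrite MK -mulnA -mulnDr rmorphB rmorph1 rmorphXn !FinRing.val_unitX.
  by rewrite rmorphXn hcompat -!exprM (mulnA l) (mulnC l) !mulnA.
split=> cedf; split=> //.
- by rewrite MK (leq_trans hm) // leq_pmull.
- case/fset0Pn: hS0 => c Sc; apply/fset0Pn; exists (K * c)%N.
  by apply/imfsetP; exists c.
- exact: power_coset_disjoint M_gt0 ob'.
- exact: card_power_coset M_gt0 ob'.
- move=> h nz_h.
  (* [h] may lie outside the image of [iota], but [h * d = iota g] has the same count, and
     [transfer] computes it. *)
  have [g [d d_in def_g]] :=
    rmorph_power_residue htheta' hcompat coprime_Kl K_gt0 nz_h.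
  have nz_g : g != 0.
    by rewrite -(fmorph_eq0 iota) def_g mulf_neq0 // -unitfE (valP d).
  rewrite -(cedf_diff cedf nz_g) -transfer // def_g.
  rewrite !(external_differences_power_coset M_gt0 ob') //.
  by under [RHS]eq_bigr do under eq_bigr do rewrite exists_cycle_mul //.
- exact: power_coset_disjoint m_gt0 ob.
- exact: card_power_coset m_gt0 ob.
- move=> g nz_g; rewrite -transfer // (cedf_diff cedf) //.
  by rewrite fmorph_eq0.
Qed.
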